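(* The translation $(-)^\natural$ of $\mathsf{MIPC}$ into $\mathsf{TS4}$ is full and faithful; that is, for every formula $\varphi$ of $\mathcal L_{\forall\exists}$, $$\mathsf{MIPC}\vdash\varphi \quad\text{iff}\quad \mathsf{TS4}\vdash\varphi^\natural .$$
   Context: **MIPC.** $\mathcal L_{\forall\exists}$ is the propositional language with connectives $\bot,\wedge,\vee,\to$ (with $\neg\varphi:=\varphi\to\bot$) and two unary modalities $\forall,\exists$. The monadic intuitionistic propositional calculus $\mathsf{MIPC}$ is the least intuitionistic modal logic in $\mathcal L_{\forall\exists}$ containing all theorems of the intuitionistic propositional calculus; the axioms $\forall(p\wedge q)\leftrightarrow(\forall p\wedge\forall q)$, $\forall p\to p$, $\forall p\to\forall\forall p$; the axioms $\exists(p\vee q)\leftrightarrow(\exists p\vee\exists q)$, $p\to\exists p$, $\exists\exists p\to\exists p$, $(\exists p\wedge\exists q)\to\exists(\exists p\wedge q)$; the axioms $\exists\forall p\leftrightarrow\forall p$, $\exists p\leftrightarrow\forall\exists p$; and closed under modus ponens, substitution, necessitation ($\varphi/\forall\varphi$), and replacement of provable equivalents (from $\varphi\leftrightarrow\psi$ infer $\forall\varphi\leftrightarrow\forall\psi$ and $\exists\varphi\leftrightarrow\exists\psi$). **TS4.** $\mathcal{ML}$ is the classical propositional language with three unary modalities $\Box,\blacksquare_F,\blacksquare_P$; $\Diamond:=\neg\Box\neg$. $\mathsf{TS4}$ is the least set of $\mathcal{ML}$-formulas containing all classical tautologies; the $\mathsf{S4}$-axioms $\blacksquare(p\to q)\to(\blacksquare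 p\to\blacksquare q)$, $\blacksquare p\to p$, $\blacksquare p\to\blacksquare\blacksquare p$ for each $\blacksquare\in\{\Box,\blacksquare_F,\blacksquare_P\}$; the tense axioms $p\to\blacksquare_P\neg\blacksquare_F\neg p$ and $p\to\blacksquare_F\neg\blacksquare_P\neg p$; the connecting axioms $\Diamond p\to\neg\blacksquare_F\neg p$ and $\neg\blacksquare_F\neg p\to\Diamond(\neg\blacksquare_F\neg p\wedge\neg\blacksquare_P\neg p)$; and closed under modus ponens, substitution, and necessitation for $\Box,\blacksquare_F,\blacksquare_P$. **Translation.** $(-)^\natural$ maps $\mathcal L_{\forall\exists}$-formulas to $\mathcal{ML}$-formulas: $\bot^\natural=\bot$; $p^\natural=\Box p$ for each propositional letter $p$; $(\varphi\wedge\psi)^\natural=\varphi^\natural\wedge\psi^\natural$; $(\varphi\vee\psi)^\natural=\varphi^\natural\vee\psi^\natural$; $(\varphi\to\psi)^\natural=\Box(\neg\varphi^\natural\vee\psi^\natural)$; $(\forall\varphi)^\natural=\blacksquare_F\varphi^\natural$; $(\exists\varphi)^\natural=\neg\blacksquare_P\neg\varphi^\natural$. *)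

(* Defs.v *)
From Stdlib Require Import Bool.

(** Propositional letters are the natural numbers, in all three languages. *)
Definition letter := nat.

Inductive pform : Type :=
| PVar (p : letter)
| PBot
| PAnd (a b : pform)
| POr (a b : pform)
| PImp (a b : pform).

Inductive IPC : pform -> Prop :=
| IPC_K a b : IPC (PImp a (PImp b a))
| IPC_S a b c :
    IPC (PImp (PImp a (PImp b c)) (PImp (PImp a b) (PImp a c)))
| IPC_andl a b : IPC (PImp (PAnd a b) a)
| IPC_andr a b : IPC (PImp (PAnd a b) b)
| IPC_pair a b : IPC (PImp a (PImp b (PAnd a b)))
| IPC_orl a b : IPC (PImp a (POr a b))
| IPC_orr a b : IPC (PImp b (POr a b))
| IPC_case a b c :
    IPC (PImp (PImp a c) (PImp (PImp b c) (PImp (POr a b) c)))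
| IPC_exfalso a : IPC (PImp PBot a)
| IPC_mp a b : IPC (PImp a b) -> IPC a -> IPC b.

Fixpoint peval (v : letter -> bool) (a : pform) : bool :=
  match a with
  | PVar p => v p
  | PBot => false
  | PAnd a b => peval v a && peval v b
  | POr a b => peval v a || peval v b
  | PImp a b => implb (peval v a) (peval v b)
  end.

Definition tautology (a : pform) : Prop :=
  forall v : letter -> bool, peval v a = true.

Inductive form : Type :=
| Var (p : letter)
| Bot
| And (a b : form)
| Or (a b : form)
| Imp (a b : form)
| All (a : form)
| Ex (a : form).

Definition Iff (a b : form) : form := And (Imp a b) (Imp b a).

Fixpoint subst (s : letter -> form) (a : form) : form :=
  match a with
  | Var p => s p
  | Bot => Bot
  | And a b => And (subst s a) (subst s b)
  | Or a b => Or (subst s a) (subst s b)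
  | Imp a b => Imp (subst s a) (subst s b)
  | All a => All (subst s a)
  | Ex a => Ex (subst s a)
  end.

Fixpoint form_of_pform (a : pform) : form :=
  match a with
  | PVar p => Var p
  | PBot => Bot
  | PAnd a b => And (form_of_pform a) (form_of_pform b)
  | POr a b => Or (form_of_pform a) (form_of_pform b)
  | PImp a b => Imp (form_of_pform a) (form_of_pform b)
  end.

(** The axioms are single formulas in two fixed letters; their instances come
    from the substitution rule of [MIPC]. *)
Inductive MIPC_axiom : form -> Prop :=
| MIPC_all_and (p := Var 0) (q := Var 1) :
    MIPC_axiom (Iff (All (And p q)) (And (All p) (All q)))
| MIPC_all_refl (p := Var 0) : MIPC_axiom (Imp (All p) p)
| MIPC_all_trans (p := Var 0) : MIPC_axiom (Imp (All p) (All (All p)))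
| MIPC_ex_or (p := Var 0) (q := Var 1) :
    MIPC_axiom (Iff (Ex (Or p q)) (Or (Ex p) (Ex q)))
| MIPC_ex_refl (p := Var 0) : MIPC_axiom (Imp p (Ex p))
| MIPC_ex_trans (p := Var 0) : MIPC_axiom (Imp (Ex (Ex p)) (Ex p))
| MIPC_ex_and (p := Var 0) (q := Var 1) :
    MIPC_axiom (Imp (And (Ex p) (Ex q)) (Ex (And (Ex p) q)))
| MIPC_ex_all (p := Var 0) : MIPC_axiom (Iff (Ex (All p)) (All p))
| MIPC_all_ex (p := Var 0) : MIPC_axiom (Iff (Ex p) (All (Ex p))).

Inductive MIPC : form -> Prop :=
| MIPC_ipc a : IPC a -> MIPC (form_of_pform a)
| MIPC_ax a : MIPC_axiom a -> MIPC a
| MIPC_mp a b : MIPC (Imp a b) -> MIPC a -> MIPC b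
| MIPC_subst s a : MIPC a -> MIPC (subst s a)
| MIPC_nec a : MIPC a -> MIPC (All a)
| MIPC_repl_all a b : MIPC (Iff a b) -> MIPC (Iff (All a) (All b))
| MIPC_repl_ex a b : MIPC (Iff a b) -> MIPC (Iff (Ex a) (Ex b)).

(** Indices of the three modalities [□], [■_F] and [■_P]. *)
Inductive modality : Type := mBox | mF | mP.

Inductive mform : Type :=
| MVar (p : letter)
| MBot
| MAnd (a b : mform)
| MOr (a b : mform)
| MImp (a b : mform)
| Nec (m : modality) (a : mform).

Definition MNeg (a : mform) : mform := MImp a MBot.
Definition Dia (a : mform) : mform := MNeg (Nec mBox (MNeg a)).

Fixpoint msubst (s : letter -> mform) (a : mform) : mform :=
  match a with
  | MVar p => s p
  | MBot => MBot
  | MAnd a b => MAnd (msubst s a) (msubst s b)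
  | MOr a b => MOr (msubst s a) (msubst s b)
  | MImp a b => MImp (msubst s a) (msubst s b)
  | Nec m a => Nec m (msubst s a)
  end.

Fixpoint mform_of_pform (a : pform) : mform :=
  match a with
  | PVar p => MVar p
  | PBot => MBot
  | PAnd a b => MAnd (mform_of_pform a) (mform_of_pform b)
  | POr a b => MOr (mform_of_pform a) (mform_of_pform b)
  | PImp a b => MImp (mform_of_pform a) (mform_of_pform b)
  end.

Inductive TS4_axiom : mform -> Prop :=
| TS4_K m (p := MVar 0) (q := MVar 1) :
    TS4_axiom (MImp (Nec m (MImp p q)) (MImp (Nec m p) (Nec m q)))
| TS4_refl m (p := MVar 0) : TS4_axiom (MImp (Nec m p) p)
| TS4_trans m (p := MVar 0) : TS4_axiom (MImp (Nec m p) (Nec m (Nec m p)))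
| TS4_tense_PF (p := MVar 0) :
    TS4_axiom (MImp p (Nec mP (MNeg (Nec mF (MNeg p)))))
| TS4_tense_FP (p := MVar 0) :
    TS4_axiom (MImp p (Nec mF (MNeg (Nec mP (MNeg p)))))
| TS4_dia_F (p := MVar 0) :
    TS4_axiom (MImp (Dia p) (MNeg (Nec mF (MNeg p))))
| TS4_F_dia (p := MVar 0) :
    TS4_axiom
      (MImp (MNeg (Nec mF (MNeg p)))
            (Dia (MAnd (MNeg (Nec mF (MNeg p))) (MNeg (Nec mP (MNeg p)))))).

(** Only modality-free tautologies are taken as a base; tautologies with
    modal subformulas are their substitution instances. *)
Inductive TS4 : mform -> Prop :=
| TS4_taut a : tautology a -> TS4 (mform_of_pform a)
| TS4_ax a : TS4_axiom a -> TS4 a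
| TS4_mp a b : TS4 (MImp a b) -> TS4 a -> TS4 b
| TS4_subst s a : TS4 a -> TS4 (msubst s a)
| TS4_nec m a : TS4 a -> TS4 (Nec m a).

Fixpoint natural (a : form) : mform :=
  match a with
  | Var p => Nec mBox (MVar p)
  | Bot => MBot
  | And a b => MAnd (natural a) (natural b)
  | Or a b => MOr (natural a) (natural b)
  | Imp a b => Nec mBox (MOr (MNeg (natural a)) (natural b))
  | All a => Nec mF (natural a)
  | Ex a => MNeg (Nec mP (MNeg (natural a)))
  end.

(* Main.v *)
From mathcomp Require Import all_boot boolp classical_sets.
Require Import Defs.

Set Implicit Arguments.
Unset Strict Implicit.
Unset Printing Implicit Defensive.

Arguments MIPC_mp {a b}.
Arguments MIPC_subst s {a}.
Arguments MIPC_ax {a}.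
Arguments MIPC_nec {a}.
Arguments MIPC_repl_all {a b}.
Arguments MIPC_repl_ex {a b}.
Arguments TS4_mp {a b}.
Arguments TS4_subst s {a}.
Arguments TS4_ax {a}.
Arguments TS4_nec m {a}.

(** Both logics are characterised by the same class of relational frames
    [(W, R, Q)]: [R] and [Q] are quasi-orders with [R] included in [Q], and
    [x Q y] implies that there is [z] with [x R z], [z Q y] and [y Q z].
    On such a frame formulas of MIPC are forced intuitionistically along [R],
    with [All] read along [Q] and [Ex] along the converse of [Q], while [mBox],
    [mF] and [mP] are read along [R], [Q] and the converse of [Q].

    The translation is semantically transparent ([meval_natural]): the truth
    value of [natural a] under a valuation [V] is the forcing value of [a] under
    the [R]-interior of [V], which is persistent, and every persistent
    valuation is its own interior.  Hence [a] is forced everywhere on all frames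
    under all persistent valuations iff [natural a] is true everywhere on all
    frames under all valuations, and the theorem follows
    from soundness and completeness of the two calculi ([MIPC_sound],
    [MIPC_complete], [TS4_sound], [TS4_complete]).

    Each completeness proof uses a canonical model, whose worlds are the prime
    filters of the Lindenbaum preorder of the logic; for TS4 these are the
    maximal consistent theories.  All worlds that are needed come from one
    separation theorem ([prime_separation]): a filter and a disjoint ideal of a
    distributive lattice are separated by a prime filter.  The delicate worlds
    are the intermediate [z] above.  For TS4, with [x Q y], the filter
    [{c | mBox c in x}] is disjoint from the ideal generated by the formulas
    [mF b \/ mP b] with [b] not in [y], because TS4 proves
    [mBox (mF b \/ mP b) -> mF b] ([TS4_box_F_or_P]).  For MIPC, the filter
    generated by [x] and by the formulas [d] in [y] with [d -> All d] provable
    is disjoint from the ideal generated by the formulas of that kind outside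
    [y], because of the axiom [Ex p /\ Ex q -> Ex (Ex p /\ q)]. *)

(** * Prime filters in distributive lattices *)

(** A bounded distributive lattice given by a preorder, so that the formulas of
    a logic form one under provable implication, without passing to the
    quotient by provable equivalence. *)
Record dlattice := DLattice {
  car :> Type;
  le : car -> car -> Prop;
  meet : car -> car -> car;
  join : car -> car -> car;
  bot : car;
  top : car;
  le_refl : forall a, le a a;
  le_trans : forall b a c, le a b -> le b c -> le a c;
  meet_l : forall a b, le (meet a b) a;
  meet_r : forall a b, le (meet a b) b;
  meet_glb : forall a b c, le a b -> le a c -> le a (meet b c);
  join_l : forall a b, le a (join a b);
  join_r : forall a b, le b (join a b);
  join_lub : forall a b c, le a c -> le b c -> le (join a b) c;
  bot_le : forall a, le bot a;
  le_top : forall a, le a top;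
  meet_join : forall a b c, le (meet a (join b c)) (join (meet a b) (meet a c))
}.

Section PrimeFilters.
Variable L : dlattice.
Implicit Types (a b c d : L) (F I P : L -> Prop).

Definition is_filter F : Prop :=
  [/\ F (top L), forall a b, le a b -> F a -> F b
    & forall a b, F a -> F b -> F (meet a b)].

Definition is_ideal I : Prop :=
  [/\ I (bot L), forall a b, le a b -> I b -> I a
    & forall a b, I a -> I b -> I (join a b)].

Definition is_prime P : Prop :=
  [/\ is_filter P, ~ P (bot L) & forall a b, P (join a b) -> P a \/ P b].

Lemma meet_mono a b c d : le a b -> le c d -> le (meet a c) (meet b d).
Proof.
move=> ab cd; apply: meet_glb.
- exact: le_trans (meet_l _ _) ab.
- exact: le_trans (meet_r _ _) cd.
Qed.

Lemma join_mono a b c d : le a b -> le c d -> le (join a c) (join b d).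
Proof.
move=> ab cd; apply: join_lub.
- exact: le_trans ab (join_l _ _).
- exact: le_trans cd (join_r _ _).
Qed.

Lemma principal_filter a : is_filter (le a).
Proof.
by split=> [|b c bc ab|b c]; [exact: le_top | exact: le_trans bc | exact: meet_glb].
Qed.

Lemma principal_ideal a : is_ideal (fun b => le b a).
Proof.
by split=> [|b c bc ca|b c]; [exact: bot_le | exact: le_trans ca | exact: join_lub].
Qed.

(** The filter generated by [F] and [a]. *)
Definition adjoin F a : L -> Prop := fun c => exists2 p, F p & le (meet p a) c.

Lemma adjoin_filter F a : is_filter F -> is_filter (adjoin F a).
Proof.
move=> [F1 Fup FI]; split.
- by exists (top L) => //; exact: le_top.
- by move=> b c bc [p Fp pb]; exists p => //; exact: le_trans bc.
- move=> b c [p Fp pb] [q Fq qc]; exists (meet p q); first exact: FI.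
  apply: meet_glb; [apply: le_trans pb | apply: le_trans qc].
  + by apply: meet_mono; [exact: meet_l | exact: le_refl].
  + by apply: meet_mono; [exact: meet_r | exact: le_refl].
Qed.

Lemma adjoin_sub F a b : F b -> adjoin F a b.
Proof. by move=> Fb; exists b => //; exact: meet_l. Qed.

Lemma adjoin_in F a : is_filter F -> adjoin F a a.
Proof. by move=> [F1 _ _]; exists (top L) => //; exact: meet_r. Qed.

(** The prime filter theorem: a filter that is maximal among those disjoint
    from a given ideal is prime. *)
Theorem prime_separation F I :
    is_filter F -> is_ideal I -> (forall a, F a -> I a -> False) ->
  exists P, [/\ is_prime P, forall a, F a -> P a & forall a, P a -> I a -> False].
Proof.
move=> filF [I0 Idown Ijoin] FI.
(* Zorn's lemma is applied to the sets [A] such that [F `|` A] is suitable, so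
   that the empty union of a chain also qualifies. *)
pose ok (A : set L) :=
  is_filter (F `|` A)%classic /\ (forall a, A a -> I a -> False).
have [|A [[filG AI] Amax]] := @Zorn_bigcup L ok.
  move=> C Cok Ctot; split; last by move=> a [X CX Xa]; exact: (Cok X CX).2.
  have [F1 Fup FM] := filF; split; first by left.
  - move=> a b ab [Fa|[X CX Xa]]; first by left; exact: Fup Fa.
    have [[_ Xup _] _] := Cok X CX.
    by have [Fb|Xb] := Xup a b ab (or_intror Xa); [left | right; exists X].
  - have extend X a b : C X -> (F `|` X)%classic a -> (F `|` X)%classic b ->
        (F `|` \bigcup_(X in C) X)%classic (meet a b).
      move=> CX Xa Xb; have [[_ _ XM] _] := Cok X CX.
      by have [Fc|Xc] := XM _ _ Xa Xb; [left | right; exists X].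
    move=> a b [Fa|[X CX Xa]] [Fb|[Y CY Yb]].
    + by left; exact: FM.
    + by apply: (extend Y) => //; [left | right].
    + by apply: (extend X) => //; [right | left].
    + have [XY|YX] := Ctot X Y CX CY.
      * by apply: (extend Y) => //; right => //; exact: XY.
      * by apply: (extend X) => //; right => //; exact: YX.
set G := (F `|` A)%classic in filG.
have GI a : G a -> I a -> False by case; [exact: FI | exact: AI].
have meets a : ~ G a -> exists p c, [/\ G p, I c & le (meet p a) c].
  move=> nGa; apply: contrapT => none.
  apply: (Amax (adjoin G a)); last first.
    split; last by move=> c [p Gp pc] Ic; apply: none; exists p, c.
    suff -> : (F `|` adjoin G a)%classic = adjoin G a by exact: adjoin_filter.
    apply/seteqP; split=> c; last by right.
    by case=> // Fc; apply: adjoin_sub; left.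
  split=> [c Ac|sub]; first by apply: adjoin_sub; right.
  by apply: nGa; right; apply: sub; exact: adjoin_in.
have [G1 Gup GM] := filG.
exists G; split=> //; last by left.
split=> //; first by move=> /GI; exact.
move=> a b Gab; apply: contrapT => /not_orP[/meets[p [c [Gp Ic pc]]]].
move=> /meets[q [d [Gq Id qd]]].
have Gpq := GM _ _ (GM _ _ Gp Gq) Gab.
apply: (GI (join c d)); last exact: Ijoin.
apply: Gup Gpq; apply: le_trans (meet_join _ _ _) _; apply: join_mono.
- by apply: le_trans pc; apply: meet_mono; [exact: meet_l | exact: le_refl].
- by apply: le_trans qd; apply: meet_mono; [exact: meet_r | exact: le_refl].
Qed.

(** The prime filters, as the type of worlds of a canonical frame. *)
Definition world := {P : L -> Prop | is_prime P}.

Definition holds (x : world) (a : L) : Prop := sval x a.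

Lemma holds_le (x : world) a b : le a b -> holds x a -> holds x b.
Proof. by case: x => P [[P1 Pup PM] P0 Pj] /=; exact: Pup. Qed.

Lemma holds_top (x : world) : holds x (top L).
Proof. by case: x => P [[]]. Qed.

Lemma holds_thm (x : world) a : le (top L) a -> holds x a.
Proof. by move=> Ta; exact: holds_le Ta (holds_top x). Qed.

Lemma holds_bot (x : world) : ~ holds x (bot L).
Proof. by case: x => P []. Qed.

Lemma holds_meet (x : world) a b : holds x (meet a b) <-> holds x a /\ holds x b.
Proof.
split=> [xab|]; last by case: x => P [[P1 Pup PM] P0 Pj] /= []; exact: PM.
by split; [exact: holds_le (meet_l _ _) xab | exact: holds_le (meet_r _ _) xab].
Qed.

Lemma holds_join (x : world) a b : holds x (join a b) <-> holds x a \/ holds x b.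
Proof.
split=> [|[]]; first by case: x => P [fP P0 Pj] /=; exact: Pj.
- exact: holds_le (join_l _ _).
- exact: holds_le (join_r _ _).
Qed.

Lemma holds_filter (x : world) : is_filter (holds x).
Proof. by case: x => P []. Qed.

Lemma world_separation F I :
    is_filter F -> is_ideal I -> (forall a, F a -> I a -> False) ->
  exists x : world,
    (forall a, F a -> holds x a) /\ (forall a, I a -> ~ holds x a).
Proof.
move=> fF iI FI; have [P [pP FP PI]] := prime_separation fF iI FI.
by exists (exist _ P pP); split=> // a Ia Pa; exact: PI Ia.
Qed.

End PrimeFilters.

(** * Frames and the translation *)

(** The common frames of MIPC and TS4. *)
Record frame := Frame {
  point :> Type;
  R : point -> point -> Prop;
  Q : point -> point -> Prop;
  R_refl : forall x, R x x;
  R_trans : forall x y z, R x y -> R y z -> R x z;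
  Q_refl : forall x, Q x x;
  Q_trans : forall x y z, Q x y -> Q y z -> Q x z;
  R_Q : forall x y, R x y -> Q x y;
  Q_factor : forall x y, Q x y -> exists z, [/\ R x z, Q z y & Q y z]
}.

Section Semantics.
Variable F : frame.
Implicit Types (V : letter -> F -> Prop) (x y z : F).

Definition persistent V : Prop := forall p x y, R x y -> V p x -> V p y.

(** Intuitionistic forcing; it is meant for persistent [V]. *)
Fixpoint force V x (a : form) : Prop :=
  match a with
  | Var p => V p x
  | Bot => False
  | And a b => force V x a /\ force V x b
  | Or a b => force V x a \/ force V x b
  | Imp a b => forall y, R x y -> force V y a -> force V y b
  | All a => forall y, Q x y -> force V y a
  | Ex a => exists2 y, Q y x & force V y a
  end.

(** The accessibility relation of each modality. *)
Definition acc (m : modality) x y : Prop :=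
  match m with mBox => R x y | mF => Q x y | mP => Q y x end.

(** Classical truth. *)
Fixpoint meval V x (a : mform) : Prop :=
  match a with
  | MVar p => V p x
  | MBot => False
  | MAnd a b => meval V x a /\ meval V x b
  | MOr a b => meval V x a \/ meval V x b
  | MImp a b => meval V x a -> meval V x b
  | Nec m a => forall y, acc m x y -> meval V y a
  end.

(** The [R]-interior of a valuation. *)
Definition interior V : letter -> F -> Prop := fun p x => forall y, R x y -> V p y.

Lemma interior_persistent V : persistent (interior V).
Proof. by move=> p x y xy Vx z yz; apply: Vx; exact: R_trans yz. Qed.

Lemma interior_id V : persistent V -> interior V = V.
Proof.
move=> pV; apply/funext => p; apply/funext => x; apply/propext.
by split=> [|Vx y xy]; [apply; exact: R_refl | exact: pV Vx].
Qed.

Lemma meval_natural V a x :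
  meval V x (natural a) <-> force (interior V) x a.
Proof.
elim: a x => [p||a IHa b IHb|a IHa b IHb|a IHa b IHb|a IHa|a IHa] x //=.
- by rewrite IHa IHb.
- by rewrite IHa IHb.
- split=> H y xy; first by rewrite -IHa -IHb => ya; case: (H y xy).
  have [ya|] := pselect (meval V y (natural a)); last by left.
  by right; apply/IHb; apply: H => //; apply/IHa.
- by split=> H y xy; apply/IHa; exact: H.
- split=> [H|[y yx /IHa ya] H]; last exact: (H y).
  by apply: contrapT => none; apply: H => y yx /IHa ya; apply: none; exists y.
Qed.

Lemma force_persistent V a x y :
  persistent V -> R x y -> force V x a -> force V y a.
Proof.
move=> pV; elim: a x y => [p||a IHa b IHb|a IHa b IHb|a _ b _|a _|a _] x y xy //=.
- exact: pV.
- by move=> [xa xb]; split; [exact: IHa xa | exact: IHb xb].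
- by move=> [xa|xb]; [left; exact: IHa xa | right; exact: IHb xb].
- by move=> H z yz; apply: H; exact: R_trans yz.
- by move=> H z yz; apply: H; apply: Q_trans yz; exact: R_Q.
- by move=> [z zx za]; exists z => //; apply: Q_trans zx _; exact: R_Q.
Qed.

Lemma force_subst V s a x :
  force V x (subst s a) <-> force (fun p y => force V y (s p)) x a.
Proof.
elim: a x => [p||a IHa b IHb|a IHa b IHb|a IHa b IHb|a IHa|a IHa] x //=.
- by rewrite IHa IHb.
- by rewrite IHa IHb.
- by split=> H y xy /IHa ya; apply/IHb; exact: H.
- by split=> H y xy; apply/IHa; exact: H.
- by split=> -[y yx ya]; exists y => //; apply/IHa.
Qed.

Lemma meval_subst V s a x :
  meval V x (msubst s a) <-> meval (fun p y => meval V y (s p)) x a.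
Proof.
elim: a x => [p||a IHa b IHb|a IHa b IHb|a IHa b IHb|m a IHa] x //=.
- by rewrite IHa IHb.
- by rewrite IHa IHb.
- by rewrite IHa IHb.
- by split=> H y xy; apply/IHa; exact: H.
Qed.

(** * Soundness *)

Lemma IPC_sound a V x : persistent V -> IPC a -> force V x (form_of_pform a).
Proof.
move=> pV; have up c y z := @force_persistent V c y z pV.
move=> H; elim: H x => {a} /=.
- by move=> a b x y _ ya z yz _; exact: up ya.
- move=> a b c x y _ yabc z yz zab t zt ta.
  by apply: (yabc t _ ta t (R_refl t)); [exact: R_trans zt | exact: zab].
- by move=> a b x y _ [].
- by move=> a b x y _ [].
- by move=> a b x y _ ya z yz zb; split=> //; exact: up ya.
- by move=> a b x y _ ya; left.
- by move=> a b x y _ ya; right.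
- move=> a b c x y _ yac z yz zbc t zt [ta|tb].
  + by apply: yac => //; exact: R_trans zt.
  + exact: zbc.
- by [].
- by move=> a b _ IHab _ IHa x; exact: (IHab x x (R_refl x)).
Qed.

Lemma MIPC_axiom_sound a V x : persistent V -> MIPC_axiom a -> force V x a.
Proof.
move=> pV [] /=.
- split=> y _; last by move=> [p q] z yz; split; [exact: p | exact: q].
  by move=> pq; split=> z yz; case: (pq z yz).
- by move=> y _; apply; exact: Q_refl.
- by move=> y _ p z yz t zt; apply: p; exact: Q_trans zt.
- split=> y _.
  + by move=> [z zy [zp|zq]]; [left | right]; exists z.
  + by move=> [[z zy zp]|[z zy zq]]; exists z => //; [left | right].
- by move=> y _ yp; exists y => //; exact: Q_refl.
- by move=> y _ [z zy [t tz tp]]; exists t => //; exact: Q_trans zy.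
- move=> y _ [[u uy up] [v vy vq]].
  have [z [vz zy yz]] := Q_factor vy.
  exists z => //; split; last exact: pV vq.
  by exists u => //; exact: Q_trans yz.
- split=> y _; last by move=> yp; exists y => //; exact: Q_refl.
  by move=> [z zy zp] t yt; apply: zp; exact: Q_trans yt.
- split=> y _; last by apply; exact: Q_refl.
  by move=> [z zy zp] t yt; exists z => //; exact: Q_trans yt.
Qed.

Theorem MIPC_sound a V x : persistent V -> MIPC a -> force V x a.
Proof.
move=> pV Ha; elim: Ha V pV x => {a}.
- by move=> a Ha V pV x; exact: IPC_sound.
- by move=> a Ha V pV x; exact: MIPC_axiom_sound.
- by move=> a b _ IHab _ IHa V pV x; apply: (IHab V pV x x (R_refl x)); exact: IHa.
- move=> s a _ IHa V pV x; apply/force_subst; apply: IHa => p y z yz.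
  exact: force_persistent.
- by move=> a _ IHa V pV x y _; exact: IHa.
- move=> a b _ IH V pV x /=; split=> y _ H z yz; have [ab ba] := IH V pV z.
  + by apply: ab (R_refl z) _; exact: H.
  + by apply: ba (R_refl z) _; exact: H.
- move=> a b _ IH V pV x /=; split=> y _ [z zy za]; have [ab ba] := IH V pV z.
  + by exists z => //; exact: ab (R_refl z) _.
  + by exists z => //; exact: ba (R_refl z) _.
Qed.

Lemma taut_sound a V x : tautology a -> meval V x (mform_of_pform a).
Proof.
move=> Ta; have := Ta (fun p => `[< V p x >]).
suff E b : peval (fun p => `[< V p x >]) b <-> meval V x (mform_of_pform b).
  by move=> H; apply/E.
elim: b => [p||b IHb c IHc|b IHb c IHc|b IHb c IHc] //=.
- by split=> /asboolP.
- by rewrite -IHb -IHc; split=> /andP.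
- by rewrite -IHb -IHc; split=> /orP.
- by rewrite -IHb -IHc; split=> /implyP.
Qed.

Lemma TS4_axiom_sound a V x : TS4_axiom a -> meval V x a.
Proof.
move=> [] /=.
- by move=> m pq p y xy; apply: pq => //; exact: p.
- by move=> m; apply; case: m => /=; [exact: R_refl | exact: Q_refl ..].
- move=> m p y xy z yz; apply: p; case: m xy yz => /= xy yz.
  + exact: R_trans yz.
  + exact: Q_trans yz.
  + exact: Q_trans xy.
- by move=> p y yx np; exact: np p.
- by move=> p y yx np; exact: np p.
- by move=> H np; apply: H => y xy; apply: np; exact: R_Q.
- move=> H none; apply: H => y xy py.
  have [z [xz zy yz]] := Q_factor xy.
  by apply: (none z xz); split=> H; exact: (H y).
Qed.

Theorem TS4_sound a V x : TS4 a -> meval V x a.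
Proof.
move=> Ha; elim: Ha V x => {a}.
- by move=> a Ta V x; exact: taut_sound.
- by move=> a Ha V x; exact: TS4_axiom_sound.
- by move=> a b _ IHab _ IHa V x; apply: (IHab V x); exact: IHa.
- by move=> s a _ IHa V x; apply/meval_subst; exact: IHa.
- by move=> m a _ IHa V x y _; exact: IHa.
Qed.

End Semantics.

(** * Completeness of TS4 *)

(** Letters 0, 1, 2 are sent to the three given formulas, and all others to
    the last one. *)
Definition inst3 {T : Type} (a b c : T) (p : letter) : T :=
  match p with 0 => a | 1 => b | _ => c end.

Lemma TS4_inst t a b c :
  tautology t -> TS4 (msubst (inst3 a b c) (mform_of_pform t)).
Proof. by move=> Tt; apply: TS4_subst; exact: TS4_taut. Qed.

Ltac truth_table := let v := fresh "v" in
  move=> v /=; case: (v 0); case: (v 1); case: (v 2); reflexivity.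

Local Notation p0 := (PVar 0).
Local Notation p1 := (PVar 1).
Local Notation p2 := (PVar 2).

(** Provable implication, the order of the Lindenbaum preorder. *)
Definition TS4le (a b : mform) : Prop := TS4 (MImp a b).

Definition TS4_lattice : dlattice.
Proof.
apply: (@DLattice mform TS4le MAnd MOr MBot (MImp MBot MBot)).
- by move=> a; apply: (@TS4_inst (PImp p0 p0) a a a); truth_table.
- move=> b a c ab bc; apply: (TS4_mp _ bc); apply: (TS4_mp _ ab).
  apply: (@TS4_inst (PImp (PImp p0 p1) (PImp (PImp p1 p2) (PImp p0 p2))) a b c).
  by truth_table.
- by move=> a b; apply: (@TS4_inst (PImp (PAnd p0 p1) p0) a b b); truth_table.
- by move=> a b; apply: (@TS4_inst (PImp (PAnd p0 p1) p1) a b b); truth_table.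
- move=> a b c ab ac; apply: (TS4_mp _ ac); apply: (TS4_mp _ ab).
  apply: (@TS4_inst
    (PImp (PImp p0 p1) (PImp (PImp p0 p2) (PImp p0 (PAnd p1 p2)))) a b c).
  by truth_table.
- by move=> a b; apply: (@TS4_inst (PImp p0 (POr p0 p1)) a b b); truth_table.
- by move=> a b; apply: (@TS4_inst (PImp p1 (POr p0 p1)) a b b); truth_table.
- move=> a b c ac bc; apply: (TS4_mp _ bc); apply: (TS4_mp _ ac).
  apply: (@TS4_inst
    (PImp (PImp p0 p2) (PImp (PImp p1 p2) (PImp (POr p0 p1) p2))) a b c).
  by truth_table.
- by move=> a; apply: (@TS4_inst (PImp PBot p0) a a a); truth_table.
- by move=> a; apply: (@TS4_inst (PImp p0 (PImp PBot PBot)) a a a); truth_table.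
- move=> a b c; apply: (@TS4_inst
    (PImp (PAnd p0 (POr p1 p2)) (POr (PAnd p0 p1) (PAnd p0 p2))) a b c).
  by truth_table.
Defined.

Lemma TS4_nec_mono m a b : TS4le a b -> TS4le (Nec m a) (Nec m b).
Proof.
move=> ab; apply: (TS4_mp _ (TS4_nec m ab)).
exact: (TS4_subst (inst3 a b b) (TS4_ax (TS4_K m))).
Qed.

Lemma TS4_nec_and m a b :
  TS4le (MAnd (Nec m a) (Nec m b)) (Nec m (MAnd a b)).
Proof.
have K : TS4le (Nec m a) (MImp (Nec m b) (Nec m (MAnd a b))).
  apply: (@le_trans TS4_lattice (Nec m (MImp b (MAnd a b)))).
    apply: TS4_nec_mono.
    by apply: (@TS4_inst (PImp p0 (PImp p1 (PAnd p0 p1))) a b b); truth_table.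
  exact: (TS4_subst (inst3 b (MAnd a b) b) (TS4_ax (TS4_K m))).
apply: (TS4_mp _ K); apply: (@TS4_inst
  (PImp (PImp p0 (PImp p1 p2)) (PImp (PAnd p0 p1) p2)) (Nec m a) (Nec m b)).
by truth_table.
Qed.

Lemma TS4_contrapose a b : TS4le (MNeg a) b -> TS4le (MNeg b) a.
Proof.
apply: TS4_mp; apply: (@TS4_inst
  (PImp (PImp (PImp p0 PBot) p1) (PImp (PImp p1 PBot) p0)) a b b).
by truth_table.
Qed.

Lemma TS4_negneg a : TS4le (MNeg (MNeg a)) a.
Proof. exact: TS4_contrapose (le_refl (d := TS4_lattice) _). Qed.

Lemma TS4_F_box a : TS4le (Nec mF a) (Nec mBox a).
Proof.
apply: (@le_trans TS4_lattice (Nec mF (MNeg (MNeg a)))).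
  apply: TS4_nec_mono.
  by apply: (@TS4_inst (PImp p0 (PImp (PImp p0 PBot) PBot)) a a a); truth_table.
apply: (@le_trans TS4_lattice (Nec mBox (MNeg (MNeg a)))); last first.
  exact: TS4_nec_mono (TS4_negneg a).
have H := TS4_subst (inst3 (MNeg a) a a) (TS4_ax TS4_dia_F).
apply: (TS4_mp _ H); apply: (@TS4_inst
  (PImp (PImp (PImp p0 PBot) (PImp p1 PBot)) (PImp p1 p0))
  (Nec mBox (MNeg (MNeg a))) (Nec mF (MNeg (MNeg a))) a).
by truth_table.
Qed.

(** The second connecting axiom for the negation of [b], contraposed. *)
Lemma TS4_box_F_or_P b :
  TS4le (Nec mBox (MOr (Nec mF b) (Nec mP b))) (Nec mF b).
Proof.
set f := Nec mF (MNeg (MNeg b)); set q := Nec mP (MNeg (MNeg b)).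
apply: (@le_trans TS4_lattice f); last exact: TS4_nec_mono (TS4_negneg b).
apply: (@le_trans TS4_lattice (Nec mBox (MNeg (MAnd (MNeg f) (MNeg q))))).
  apply: TS4_nec_mono; apply: (@le_trans TS4_lattice (MOr f q)).
    have nn : TS4le b (MNeg (MNeg b)).
      by apply: (@TS4_inst (PImp p0 (PImp (PImp p0 PBot) PBot)) b b b); truth_table.
    by apply: (@join_mono TS4_lattice); exact: TS4_nec_mono.
  apply: (@TS4_inst
    (PImp (POr p0 p1) (PImp (PAnd (PImp p0 PBot) (PImp p1 PBot)) PBot)) f q q).
  by truth_table.
have H := TS4_subst (inst3 (MNeg b) b b) (TS4_ax TS4_F_dia).
apply: (TS4_mp _ H); apply: (@TS4_inst
  (PImp (PImp (PImp p0 PBot) (PImp p1 PBot)) (PImp p1 p0))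
  f (Nec mBox (MNeg (MAnd (MNeg f) (MNeg q)))) b).
by truth_table.
Qed.

Section TS4Canonical.
Implicit Types (x y z : world TS4_lattice) (a b c : mform).

Lemma TS4_holds_imp x a b : holds x (MImp a b) <-> (holds x a -> holds x b).
Proof.
split=> [xab xa|].
  have : holds x (MAnd a (MImp a b)) by exact/(holds_meet x).
  apply: (@holds_le TS4_lattice).
  by apply: (@TS4_inst (PImp (PAnd p0 (PImp p0 p1)) p1) a b b); truth_table.
have /(holds_join x)[xa|xb] : holds x (MOr a (MImp a b)).
- apply: (@holds_thm TS4_lattice).
  apply: (@TS4_inst (PImp (PImp PBot PBot) (POr p0 (PImp p0 p1))) a b b).
  by truth_table.
- move=> /(_ xa); apply: (@holds_le TS4_lattice).
  by apply: (@TS4_inst (PImp p1 (PImp p0 p1)) a b b); truth_table.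
- by [].
Qed.

Lemma TS4_holds_neg x a : holds x (MNeg a) <-> ~ holds x a.
Proof.
rewrite TS4_holds_imp; split=> nxa // xa.
exact: (@holds_bot TS4_lattice x) (nxa xa).
Qed.

(** The canonical accessibility relation of the modality [m]. *)
Definition can m x y : Prop := forall a, holds x (Nec m a) -> holds y a.

Lemma necessities_filter m x :
  is_filter (L := TS4_lattice) (fun a => holds x (Nec m a)).
Proof.
split=> [|a b ab|a b xa xb].
- apply: (@holds_thm TS4_lattice); apply: (TS4_mp (a := Nec m (MImp MBot MBot))).
    apply: (@TS4_inst (PImp p0 (PImp (PImp PBot PBot) p0)) _ MBot MBot).
    by truth_table.
  by apply: TS4_nec; apply: (@TS4_inst (PImp PBot PBot) MBot MBot MBot); truth_table.
- by apply: (@holds_le TS4_lattice); exact: TS4_nec_mono.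
- apply: (@holds_le TS4_lattice) (TS4_nec_and m a b) _.
  exact/(holds_meet x).
Qed.

Lemma can_nec m x a : (forall y, can m x y -> holds y a) -> holds x (Nec m a).
Proof.
move=> H; apply: contrapT => nxa.
have [|y [xy /(_ a) ya]] :=
  world_separation (necessities_filter m x) (principal_ideal (L := TS4_lattice) a).
  by move=> b xb ba; apply: nxa; apply: holds_le xb; exact: TS4_nec_mono.
by apply: ya; [exact: le_refl | exact: H].
Qed.

Lemma can_refl m x : can m x x.
Proof.
move=> a; apply: (@holds_le TS4_lattice).
exact: (TS4_subst (inst3 a a a) (TS4_ax (TS4_refl m))).
Qed.

Lemma can_trans m x y z : can m x y -> can m y z -> can m x z.
Proof.
move=> xy yz a xa; apply: yz; apply: xy; apply: holds_le xa.
exact: (TS4_subst (inst3 a a a) (TS4_ax (TS4_trans m))).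
Qed.

(** The tense axioms make [can mP] the converse of [can mF]. *)
Lemma can_P_F x y : can mP y x <-> can mF x y.
Proof.
split=> H a Ha; apply: contrapT => /TS4_holds_neg na.
- have := TS4_subst (inst3 (MNeg a) a a) (TS4_ax TS4_tense_PF).
  move=> /(@holds_le TS4_lattice y) /(_ na) /H /TS4_holds_neg; apply.
  apply: holds_le Ha; apply: TS4_nec_mono.
  by apply: (@TS4_inst (PImp p0 (PImp (PImp p0 PBot) PBot)) a a a); truth_table.
- have := TS4_subst (inst3 (MNeg a) a a) (TS4_ax TS4_tense_FP).
  move=> /(@holds_le TS4_lattice x) /(_ na) /H /TS4_holds_neg; apply.
  apply: holds_le Ha; apply: TS4_nec_mono.
  by apply: (@TS4_inst (PImp p0 (PImp (PImp p0 PBot) PBot)) a a a); truth_table.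
Qed.

Lemma can_box_F x y : can mBox x y -> can mF x y.
Proof. by move=> xy a xa; apply: xy; apply: holds_le xa; exact: TS4_F_box. Qed.

Lemma can_factor x y :
  can mF x y -> exists z, [/\ can mBox x z, can mF z y & can mF y z].
Proof.
move=> xy.
(* A filter disjoint from [I] that contains [mF b] or [mP b] has [b] in [y]. *)
pose I (c : TS4_lattice) :=
  exists2 b, ~ holds y b & TS4le c (MOr (Nec mF b) (Nec mP b)).
have idI : is_ideal I.
  split=> [|a b ab [d yd bd]|a b [c yc ac] [d yd bd]].
  - by exists MBot; [exact: (@holds_bot TS4_lattice) | exact: (@bot_le TS4_lattice)].
  - by exists d => //; exact: (@le_trans TS4_lattice) bd.
  exists (MOr c d); first by move=> /(holds_join y)[].
  have cl := @join_l TS4_lattice c d; have dr := @join_r TS4_lattice c d.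
  apply: (@join_lub TS4_lattice).
  - apply: (@le_trans TS4_lattice) ac _.
    by apply: (@join_mono TS4_lattice); exact: TS4_nec_mono.
  - apply: (@le_trans TS4_lattice) bd _.
    by apply: (@join_mono TS4_lattice); exact: TS4_nec_mono.
have [|z [xz Iz]] := world_separation (necessities_filter mBox x) idI.
  move=> a xa [b yb ab]; apply: yb; apply: xy.
  by apply: (@holds_le TS4_lattice) (TS4_box_F_or_P b) _;
  apply: holds_le xa; exact: TS4_nec_mono.
exists z; split=> //.
- move=> b zb; apply: contrapT => yb; apply: (Iz (Nec mF b)) => //.
  by exists b => //; exact: (@join_l TS4_lattice).
- apply/can_P_F => b zb; apply: contrapT => yb; apply: (Iz (Nec mP b)) => //.
  by exists b => //; exact: (@join_r TS4_lattice).
Qed.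

Definition TS4_frame : frame :=
  @Frame (world TS4_lattice) (can mBox) (can mF) (@can_refl mBox)
    (@can_trans mBox) (@can_refl mF) (@can_trans mF) can_box_F can_factor.

Lemma TS4_truth a (x : TS4_frame) :
  meval (F := TS4_frame) (fun p y => holds y (MVar p)) x a <-> holds x a.
Proof.
elim: a x => [p||a IHa b IHb|a IHa b IHb|a IHa b IHb|m a IHa] x //=.
- by split=> // /(@holds_bot TS4_lattice).
- by rewrite IHa IHb; split=> /(holds_meet x).
- by rewrite IHa IHb; split=> /(holds_join x).
- by rewrite IHa IHb TS4_holds_imp.
- have accE y : acc (F := TS4_frame) m x y <-> can m x y.
    by case: m => //=; rewrite can_P_F.
  split=> [H|xa y /accE xy]; last by apply/IHa; exact: xy.
  by apply: can_nec => y /accE xy; apply/IHa; exact: H.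
Qed.

End TS4Canonical.

Theorem TS4_complete a :
  (forall (F : frame) (V : letter -> F -> Prop) x, meval V x a) -> TS4 a.
Proof.
move=> valid; apply: contrapT => na.
have [|x [_ /(_ a) xa]] := world_separation
    (principal_filter (top TS4_lattice)) (principal_ideal (L := TS4_lattice) a).
  move=> b Tb ba; apply: na; apply: TS4_mp (le_trans Tb ba) _.
  by apply: (@TS4_inst (PImp PBot PBot) MBot MBot MBot); truth_table.
by apply: xa; [exact: le_refl | apply/TS4_truth; exact: valid].
Qed.

(** * Completeness of MIPC *)

Lemma MIPC_inst t a b c :
  IPC t -> MIPC (subst (inst3 a b c) (form_of_pform t)).
Proof. by move=> Ht; apply: MIPC_subst; exact: MIPC_ipc. Qed.

(** Provable implication, the order of the Lindenbaum preorder. *)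
Definition MIPCle (a b : form) : Prop := MIPC (Imp a b).

Lemma MIPC_weaken a b : MIPC b -> MIPCle a b.
Proof. exact: MIPC_mp (MIPC_inst b a a (IPC_K p0 p1)). Qed.

Lemma MIPC_imp_mp a b c : MIPCle a (Imp b c) -> MIPCle a b -> MIPCle a c.
Proof.
by move=> abc; exact: MIPC_mp (MIPC_mp (MIPC_inst a b c (IPC_S p0 p1 p2)) abc).
Qed.

Lemma MIPC_le_refl a : MIPCle a a.
Proof.
apply: MIPC_imp_mp (MIPC_inst a (Imp a a) a (IPC_K p0 p1)) _.
exact: (MIPC_inst a a a (IPC_K p0 p1)).
Qed.

Lemma MIPC_le_trans b a c : MIPCle a b -> MIPCle b c -> MIPCle a c.
Proof. by move=> ab bc; apply: MIPC_imp_mp ab; exact: MIPC_weaken. Qed.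

Lemma MIPC_andl a b : MIPCle (And a b) a.
Proof. exact: (MIPC_inst a b b (IPC_andl p0 p1)). Qed.

Lemma MIPC_andr a b : MIPCle (And a b) b.
Proof. exact: (MIPC_inst a b b (IPC_andr p0 p1)). Qed.

Lemma MIPC_pair a b c : MIPCle a b -> MIPCle a c -> MIPCle a (And b c).
Proof.
move=> ab; apply: MIPC_imp_mp; apply: MIPC_le_trans ab _.
exact: (MIPC_inst b c c (IPC_pair p0 p1)).
Qed.

Lemma MIPC_case a b c : MIPCle a c -> MIPCle b c -> MIPCle (Or a b) c.
Proof.
by move=> ac; exact: MIPC_mp (MIPC_mp (MIPC_inst a b c (IPC_case p0 p1 p2)) ac).
Qed.

Lemma MIPC_residuation a b c : MIPCle (And a b) c <-> MIPCle a (Imp b c).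
Proof.
split=> H; last first.
  exact: MIPC_imp_mp (MIPC_le_trans (MIPC_andl a b) H) (MIPC_andr a b).
apply: MIPC_le_trans (MIPC_inst a b b (IPC_pair p0 p1)) _.
apply: (MIPC_mp _ (MIPC_weaken b H)).
exact: (MIPC_inst b (And a b) c (IPC_S p0 p1 p2)).
Qed.

Definition MIPC_lattice : dlattice.
Proof.
apply: (@DLattice form MIPCle And Or Bot (Imp Bot Bot)).
- exact: MIPC_le_refl.
- exact: MIPC_le_trans.
- exact: MIPC_andl.
- exact: MIPC_andr.
- exact: MIPC_pair.
- by move=> a b; exact: (MIPC_inst a b b (IPC_orl p0 p1)).
- by move=> a b; exact: (MIPC_inst a b b (IPC_orr p0 p1)).
- exact: MIPC_case.
- by move=> a; exact: (MIPC_inst a a a (IPC_exfalso p0)).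
- by move=> a; apply: MIPC_weaken; exact: MIPC_le_refl.
- move=> a b c; set d := Or (And _ _) _.
  have comm e : MIPCle (And a e) d -> MIPCle e (Imp a d).
    move=> H; apply/MIPC_residuation; apply: MIPC_le_trans H.
    by apply: MIPC_pair; [exact: MIPC_andr | exact: MIPC_andl].
  have H : MIPCle (Or b c) (Imp a d).
    apply: MIPC_case; apply: comm.
    + exact: (MIPC_inst (And a b) (And a c) Bot (IPC_orl p0 p1)).
    + exact: (MIPC_inst (And a b) (And a c) Bot (IPC_orr p0 p1)).
  exact: MIPC_imp_mp (MIPC_le_trans (MIPC_andr _ _) H) (MIPC_andl _ _).
Defined.

Lemma MIPC_iff a b : MIPC (Iff a b) <-> MIPCle a b /\ MIPCle b a.
Proof.
split=> [H|[ab]]; first by split; apply: (MIPC_mp _ H);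
  [exact: MIPC_andl | exact: MIPC_andr].
by apply: MIPC_mp; apply: (MIPC_mp _ ab); exact: (MIPC_inst _ _ Bot (IPC_pair p0 p1)).
Qed.

Lemma MIPC_axiom_inst t a b : MIPC_axiom t -> MIPC (subst (inst3 a b b) t).
Proof. by move=> Ht; apply: MIPC_subst; exact: MIPC_ax. Qed.

Lemma all_and a b : MIPCle (And (All a) (All b)) (All (And a b)).
Proof. by have /MIPC_iff[] := MIPC_axiom_inst a b MIPC_all_and. Qed.

Lemma all_mono a b : MIPCle a b -> MIPCle (All a) (All b).
Proof.
move=> ab.
have /MIPC_repl_all/MIPC_iff[_ H] : MIPC (Iff (And a b) a).
  apply/MIPC_iff; split; first exact: MIPC_andl.
  by apply: MIPC_pair => //; exact: MIPC_le_refl.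
apply: MIPC_le_trans H _; have /MIPC_iff[H _] := MIPC_axiom_inst a b MIPC_all_and.
by apply: MIPC_le_trans H _; exact: MIPC_andr.
Qed.

Lemma ex_mono a b : MIPCle a b -> MIPCle (Ex a) (Ex b).
Proof.
move=> ab.
have /MIPC_repl_ex/MIPC_iff[H _] : MIPC (Iff (Or a b) b).
  apply/MIPC_iff; split; last exact: (@join_r MIPC_lattice).
  by apply: MIPC_case => //; exact: MIPC_le_refl.
apply: MIPC_le_trans H; have /MIPC_iff[_ H] := MIPC_axiom_inst a b MIPC_ex_or.
by apply: MIPC_le_trans H; exact: (@join_l MIPC_lattice).
Qed.

Lemma all_le a : MIPCle (All a) a.
Proof. exact: (MIPC_axiom_inst a a MIPC_all_refl). Qed.

Lemma all_all a : MIPCle (All a) (All (All a)).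
Proof. exact: (MIPC_axiom_inst a a MIPC_all_trans). Qed.

Lemma le_ex a : MIPCle a (Ex a).
Proof. exact: (MIPC_axiom_inst a a MIPC_ex_refl). Qed.

Lemma ex_and a b : MIPCle (And (Ex a) (Ex b)) (Ex (And (Ex a) b)).
Proof. exact: (MIPC_axiom_inst a b MIPC_ex_and). Qed.

Lemma ex_all a : MIPCle (Ex (All a)) (All a).
Proof. by have /MIPC_iff[] := MIPC_axiom_inst a a MIPC_ex_all. Qed.

Lemma all_ex a : MIPCle (Ex a) (All (Ex a)).
Proof. by have /MIPC_iff[] := MIPC_axiom_inst a a MIPC_all_ex. Qed.

(** The formulas provably equivalent to their universal closure [All a]; they
    are also those provably equivalent to [Ex a]. *)
Definition fixed (a : form) : Prop := MIPCle a (All a).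

Lemma fixed_ex a : fixed a -> MIPCle (Ex a) a.
Proof.
move=> fa; apply: MIPC_le_trans (ex_mono fa) _.
by apply: MIPC_le_trans (ex_all a) _; exact: all_le.
Qed.

Lemma fixed_and a b : fixed a -> fixed b -> fixed (And a b).
Proof.
move=> fa fb; apply: MIPC_le_trans (all_and a b).
exact: (@meet_mono MIPC_lattice).
Qed.

Lemma fixed_or a b : fixed a -> fixed b -> fixed (Or a b).
Proof.
move=> fa fb; apply: MIPC_case.
- by apply: MIPC_le_trans fa _; apply: all_mono; exact: (@join_l MIPC_lattice).
- by apply: MIPC_le_trans fb _; apply: all_mono; exact: (@join_r MIPC_lattice).
Qed.

Section MIPCCanonical.
Implicit Types (x y z : world MIPC_lattice) (a b c d : form).

(** Inclusion of prime filters and the relation given by [All] are the [R] and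
    [Q] of the canonical frame of MIPC. *)
Definition ext x y : Prop := forall a, holds x a -> holds y a.

Definition all_acc x y : Prop := forall a, holds x (All a) -> holds y a.

(** Fixed formulas are preserved along [all_acc], in particular those of the
    form [Ex a]; so [all_acc] is also the relation given by [Ex]. *)
Lemma all_accP x y :
  all_acc x y <-> forall d, fixed d -> holds x d -> holds y d.
Proof.
split=> [xy d fd xd|H a xa]; first by apply: xy; exact: holds_le xd.
apply: (@holds_le MIPC_lattice) (all_le a) _.
by apply: H => //; exact: all_all.
Qed.

(** The ideal generated by the fixed formulas outside [x]. *)
Definition unfixed x : MIPC_lattice -> Prop :=
  fun c => exists d, [/\ fixed d, ~ holds x d & MIPCle c d].

Lemma unfixed_ideal x : is_ideal (unfixed x).
Proof.
split=> [|a b ab [d [fd xd bd]]|a b [c [fc xc ac]] [d [fd xd bd]]].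
- exists Bot; split; [exact: (@bot_le MIPC_lattice) | |].
    exact: (@holds_bot MIPC_lattice).
  exact: MIPC_le_refl.
- by exists d; split=> //; exact: MIPC_le_trans bd.
- exists (Or c d); split; [exact: fixed_or | by move=> /(holds_join x)[] |].
  exact: (@join_mono MIPC_lattice).
Qed.

(** The filter generated by [x] and by the fixed formulas of [y]. *)
Definition with_fixed x y : MIPC_lattice -> Prop :=
  fun c => exists a d, [/\ holds x a, fixed d, holds y d & MIPCle (And a d) c].

Lemma with_fixed_filter x y : is_filter (with_fixed x y).
Proof.
split=> [|a b ab [p [d [xp fd yd pda]]]|a b [p [d [xp fd yd H]]] [q [e [xq fe ye K]]]].
- exists (top MIPC_lattice), (top MIPC_lattice); split.
  + exact: holds_top.
  + apply: MIPC_weaken; apply: MIPC_nec; exact: MIPC_le_refl.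
  + exact: holds_top.
  + exact: (@meet_l MIPC_lattice).
- by exists p, d; split=> //; exact: MIPC_le_trans ab.
- exists (And p q), (And d e); split; last 1 first.
  + apply: MIPC_pair; [apply: MIPC_le_trans H | apply: MIPC_le_trans K].
    * by apply: (@meet_mono MIPC_lattice); exact: MIPC_andl.
    * by apply: (@meet_mono MIPC_lattice); exact: MIPC_andr.
  + exact/(holds_meet x).
  + exact: fixed_and.
  + exact/(holds_meet y).
Qed.

Lemma ext_all_acc x y : ext x y -> all_acc x y.
Proof. by move=> xy a xa; apply: (@holds_le MIPC_lattice) (all_le a) _; exact: xy. Qed.

Lemma all_acc_refl x : all_acc x x.
Proof. by move=> a; apply: holds_le; exact: all_le. Qed.

Lemma all_acc_trans x y z : all_acc x y -> all_acc y z -> all_acc x z.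
Proof.
by move=> xy yz a xa; apply: yz; apply: xy; apply: holds_le xa; exact: all_all.
Qed.

Lemma all_acc_factor x y :
  all_acc x y -> exists z, [/\ ext x z, all_acc z y & all_acc y z].
Proof.
move=> /all_accP xy.
have [|z [Fz Iz]] := world_separation (with_fixed_filter x y) (unfixed_ideal y).
  move=> c [a [d [xa fd yd adc]]] [e [fe ye ce]]; apply: ye.
  (* [y] contains [Ex a] and [Ex d], hence [Ex (Ex d /\ a)]; but [Ex d /\ a]
     implies the fixed formula [e], so [y] contains [e]. *)
  have yExa : holds y (Ex a).
    by apply: xy (all_ex a) _; exact: (@holds_le MIPC_lattice) (le_ex a) xa.
  have : holds y (And (Ex d) (Ex a)).
    by apply/(holds_meet y); split=> //; exact: (@holds_le MIPC_lattice) (le_ex d) yd.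
  apply: holds_le; apply: MIPC_le_trans (ex_and d a) _.
  apply: MIPC_le_trans (fixed_ex fe); apply: ex_mono.
  apply: MIPC_le_trans ce; apply: MIPC_le_trans adc.
  apply: MIPC_pair; first exact: MIPC_andr.
  exact: MIPC_le_trans (MIPC_andl _ _) (fixed_ex fd).
have T (w : world MIPC_lattice) : holds w (Imp Bot Bot).
  exact: (@holds_top MIPC_lattice).
exists z; split.
- move=> a xa; apply: Fz; exists a, (Imp Bot Bot); split=> //; last exact: MIPC_andl.
  by apply: MIPC_weaken; apply: MIPC_nec; exact: MIPC_le_refl.
- apply/all_accP => d fd zd; apply: contrapT => yd; apply: (Iz d) => //.
  by exists d; split=> //; exact: MIPC_le_refl.
- apply/all_accP => d fd yd; apply: Fz; exists (Imp Bot Bot), d; split=> //.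
  exact: MIPC_andr.
Qed.

Definition MIPC_frame : frame.
Proof.
apply: (@Frame (world MIPC_lattice) ext all_acc _ _ all_acc_refl all_acc_trans
  ext_all_acc all_acc_factor).
- by move=> x a.
- by move=> x y z xy yz a xa; apply: yz; exact: xy.
Defined.

Lemma canonical_imp x a b :
  (forall y, ext x y -> holds y a -> holds y b) -> holds x (Imp a b).
Proof.
move=> H; apply: contrapT => nx.
have [|y [Fy Iy]] := world_separation
    (adjoin_filter (L := MIPC_lattice) a (holds_filter x))
    (principal_ideal (L := MIPC_lattice) b).
  move=> c [p xp pac] cb; apply: nx; apply: holds_le xp; apply/MIPC_residuation.
  exact: MIPC_le_trans cb.
apply: (Iy b); first exact: le_refl.
apply: H; last by apply: Fy; apply: adjoin_in; exact: holds_filter.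
by move=> c xc; apply: Fy; exact: adjoin_sub.
Qed.

Lemma canonical_all x a :
  (forall y, all_acc x y -> holds y a) -> holds x (All a).
Proof.
move=> H; apply: contrapT => nx.
pose F (c : MIPC_lattice) := holds x (All c).
have fF : is_filter F.
  split=> [|b c bc|b c xb xc].
  - apply: (@holds_thm MIPC_lattice); apply: MIPC_weaken; apply: MIPC_nec.
    exact: MIPC_le_refl.
  - by apply: holds_le; exact: all_mono.
  - by apply: (@holds_le MIPC_lattice) (all_and b c) _; exact/(holds_meet x).
have [|y [Fy Iy]] := world_separation fF (principal_ideal (L := MIPC_lattice) a).
  by move=> c xc ca; apply: nx; apply: holds_le xc; exact: all_mono.
by apply: (Iy a); [exact: le_refl | exact: H].
Qed.

Lemma canonical_ex x a : holds x (Ex a) -> exists2 y, all_acc y x & holds y a.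
Proof.
move=> xa.
have [|y [Fy Iy]] :=
    world_separation (principal_filter (L := MIPC_lattice) a) (unfixed_ideal x).
  move=> c ac [d [fd xd cd]]; apply: xd; apply: holds_le xa.
  by apply: MIPC_le_trans (fixed_ex fd); apply: ex_mono; exact: MIPC_le_trans cd.
exists y; last by apply: Fy; exact: le_refl.
apply/all_accP => d fd yd; apply: contrapT => xd; apply: (Iy d) => //.
by exists d; split=> //; exact: MIPC_le_refl.
Qed.

Lemma MIPC_truth a (x : MIPC_frame) :
  force (F := MIPC_frame) (fun p y => holds y (Var p)) x a <-> holds x a.
Proof.
elim: a x => [p||a IHa b IHb|a IHa b IHb|a IHa b IHb|a IHa|a IHa] x //=.
- by split=> // /(@holds_bot MIPC_lattice).
- by rewrite IHa IHb; split=> /(holds_meet x).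
- by rewrite IHa IHb; split=> /(holds_join x).
- split=> [H|xab y xy /IHa ya].
    by apply: canonical_imp => y xy ya; apply/IHb; apply: H => //; exact/IHa.
  apply/IHb; apply: (@holds_le MIPC_lattice y (And (Imp a b) a)).
    by apply/MIPC_residuation; exact: MIPC_le_refl.
  by apply/(holds_meet y); split=> //; exact: xy.
- split=> [H|xa y xy]; last by apply/IHa; exact: xy.
  by apply: canonical_all => y xy; apply/IHa; exact: H.
- split=> [[y yx /IHa ya]|/canonical_ex[y yx ya]]; last by exists y => //; exact/IHa.
  move/all_accP: yx; apply; first exact: all_ex.
  exact: (@holds_le MIPC_lattice) (le_ex a) ya.
Qed.

End MIPCCanonical.

Theorem MIPC_complete a :
  (forall (F : frame) (V : letter -> F -> Prop) x, persistent V -> force V x a) ->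
  MIPC a.
Proof.
move=> valid; apply: contrapT => na.
have [|x [_ /(_ a) xa]] := world_separation
    (principal_filter (top MIPC_lattice)) (principal_ideal (L := MIPC_lattice) a).
  move=> b Tb ba; apply: na; apply: MIPC_mp (le_trans Tb ba) _.
  exact: MIPC_le_refl.
apply: xa; [exact: le_refl | apply/MIPC_truth; apply: valid].
by move=> p x' y; exact.
Qed.

(** * The translation is full and faithful *)

Theorem theorem3p26 : forall phi : form, MIPC phi <-> TS4 (natural phi).
Proof.
move=> phi; split=> H.
- apply: TS4_complete => F V x; apply/meval_natural.
  by apply: MIPC_sound H; exact: interior_persistent.
- apply: MIPC_complete => F V x pV; rewrite -(interior_id pV).
  by apply/meval_natural; exact: TS4_sound.
Qed.
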